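(* Tensor rank over $\mathbb{C}$ is not in general multiplicative under the tensor product: there exist tensors $s$ and $t$ with $\mathrm{R}(s\otimes t)<\mathrm{R}(s)\,\mathrm{R}(t)$. Specifically, let $k\ge 1$, let $U_1,\dots,U_k$ be finite-dimensional complex vector spaces and let $t\in U_1\otimes\cdots\otimes U_k$ be a tensor with $\underline{\mathrm{R}}(t)<\mathrm{R}(t)$. Then there is an $n_0\in\mathbb{N}$ such that for all $n\ge n_0$ one has $\mathrm{R}(t^{\otimes n})<\mathrm{R}(t)^n$.
   Context: A $k$-tensor is an element of $U_1\otimes\cdots\otimes U_k$ with $U_i$ finite-dimensional vector spaces (here over $\mathbb{C}$). The tensor rank $\mathrm{R}(t)$ of a $k$-tensor $t$ is the smallest $r$ such that $t$ is a sum of $r$ simple tensors $u_1\otimes\cdots\otimes u_k$. The border rank $\underline{\mathrm{R}}(t)$ is the smallest $r$ such that $t$ is a limit (in the Euclidean topology) of a sequence of tensors in $U_1\otimes\cdots\otimes U_k$ of rank at most $r$. The tensor product of a $k$-tensor $s\in U_1\otimes\cdots\otimes U_k$ and an $\ell$-tensor $t\in V_1\otimes\cdots\otimes V_\ell$ is the $(k+\ell)$-tensor $s\otimes t\in U_1\otimes\cdots\otimes U_k\otimes V_1\otimes\cdots\otimes V_\ell$ (no tensor factors are grouped together), and $t^{\otimes n}$ is the $n$-fold tensor product, a $kn$-tensor. *)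

(* Defs.v *)
From HB Require Import structures.
From mathcomp Require Import all_boot all_order all_algebra.
From mathcomp Require Import complex.
From mathcomp Require Import all_classical all_reals all_analysis.

Set Implicit Arguments.
Unset Strict Implicit.
Unset Printing Implicit Defensive.

Import Order.TTheory GRing.Theory Num.Theory.
Import numFieldNormedType.Exports.

Local Open Scope classical_set_scope.
Local Open Scope ring_scope.

Section TensorProduct.
Variable K : fieldType.

(* For finite-dimensional U and T, the map u ⊗ t |-> (f |-> f u *: t) is a
   canonical isomorphism from U ⊗ T to the space Hom(U^*, T) of linear maps on
   the dual of U.  We take the latter as the model of U ⊗ T, so that
   U_1 ⊗ ... ⊗ U_k = U_1 ⊗ (U_2 ⊗ (... ⊗ (U_k ⊗ K))); the empty tensor product
   is the field of scalars. *)
Fixpoint tensor_space (Us : seq (vectType K)) : vectType K :=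
  if Us is U :: Vs then 'Hom('Hom(U, K^o), tensor_space Vs) else K^o.

Lemma dim_tensor_space (Us : seq (vectType K)) :
  \dim {:tensor_space Us} = (\prod_(U <- Us) \dim {:U})%N.
Proof.
elim: Us => [|U Us IH]; first by rewrite big_nil dimvf.
by rewrite big_cons -IH !dimvf; congr (_ * _)%N; exact: muln1.
Qed.

Definition pure_fun (U T : vectType K) (u : U) (v : T) (f : 'Hom(U, K^o)) : T :=
  (f u : K) *: v.

Lemma pure_fun_linear (U T : vectType K) (u : U) (v : T) : linear (pure_fun u v).
Proof.
by move=> a f g; rewrite /pure_fun add_lfunE scale_lfunE scalerDl scalerA.
Qed.

HB.instance Definition _ (U T : vectType K) (u : U) (v : T) :=
  GRing.isLinear.Build K 'Hom(U, K^o) T *:%R (pure_fun u v)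
    (pure_fun_linear u v).

(* The vector u ⊗ v of U ⊗ T. *)
Definition pure (U T : vectType K) (u : U) (v : T) : 'Hom('Hom(U, K^o), T) :=
  linfun (pure_fun u v).

Lemma pureE (U T : vectType K) (u : U) (v : T) f : pure u v f = (f u : K) *: v.
Proof. exact: lfunE. Qed.

(* A nonempty product u_1 ⊗ ... ⊗ u_k is u_1 ⊗ (... ⊗ (u_k ⊗ a)) with a = 1;
   letting a be any scalar gives the same tensors, as a can be moved into u_k,
   and makes every scalar a simple 0-tensor. *)
Fixpoint simple (Us : seq (vectType K)) : tensor_space Us -> Prop :=
  if Us is U :: Vs then
    fun t : tensor_space (U :: Vs) =>
      exists (u : U) (v : tensor_space Vs), simple v /\ t = pure u v
  else fun=> True.

Definition rank_le Us (t : tensor_space Us) (r : nat) : Prop :=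
  exists x : 'I_r -> tensor_space Us,
    (forall i, simple (x i)) /\ t = \sum_(i < r) x i.

Lemma rank_leD Us (s t : tensor_space Us) p q :
  rank_le s p -> rank_le t q -> rank_le (s + t) (p + q).
Proof.
move=> [x [xP ->]] [y [yP ->]].
exists (fun i => match fintype.split i with inl j => x j | inr j => y j end).
split; first by move=> i; case: fintype.split.
by rewrite big_split_ord /=; congr (_ + _); apply: eq_bigr => i _;
  [rewrite (unsplitK (inl i)) | rewrite (unsplitK (inr i))].
Qed.

Lemma pure_sumr (U T : vectType K) (u : U) r (x : 'I_r -> T) :
  pure u (\sum_i x i) = \sum_i pure u (x i).
Proof.
by apply/lfunP => f; rewrite pureE scaler_sumr sum_lfunE; apply: eq_bigr => i _;
  rewrite pureE.
Qed.

Lemma rank_le_pure (U : vectType K) Us (u : U) (t : tensor_space Us) r :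
  rank_le t r -> rank_le (pure u t : tensor_space (U :: Us)) r.
Proof.
move=> [x [xP ->]]; exists (fun i => pure u (x i)); split.
  by move=> i; exists u, (x i).
exact: pure_sumr.
Qed.

(* The dual vector sending u to its i-th coordinate. *)
Definition dual_coord (U : vectType K) (i : 'I_(\dim {:U})) : 'Hom(U, K^o) :=
  linfun (coord (vbasis {:U}) i : U -> K^o).

Lemma tensor_expand (U T : vectType K) (t : 'Hom('Hom(U, K^o), T)) :
  t = \sum_(i < \dim {:U}) pure (vbasis {:U})`_i (t (dual_coord i)).
Proof.
apply/lfunP => f; rewrite sum_lfunE.
under eq_bigr => i _ do rewrite pureE -linearZ.
rewrite -linear_sum; congr (t _); apply/lfunP => u; rewrite sum_lfunE.
rewrite {1}(coord_vbasis (memvf u)) linear_sum; apply: eq_bigr => i _.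
by rewrite linearZ scale_lfunE /dual_coord lfunE; exact: mulrC.
Qed.

Lemma rank_le_ex Us (t : tensor_space Us) : exists r, rank_le t r.
Proof.
elim: Us t => [|U Us IH] t.
  by exists 1%N, (fun=> t); split=> //; rewrite big_ord1.
rewrite (tensor_expand t); elim/big_ind: _ => [|x y [p xp] [q yq]|i _].
- by exists 0%N, (fun=> 0); split=> [[]//|]; rewrite big_ord0.
- by exists (p + q)%N; apply: rank_leD.
- by have [r /rank_le_pure tr] := IH (t (dual_coord i)); exists r; apply: tr.
Qed.

Lemma tensor_rank_ex Us (t : tensor_space Us) : exists r, `[< rank_le t r >].
Proof. by have [r tr] := rank_le_ex t; exists r; apply/asboolP. Qed.

Definition tensor_rank Us (t : tensor_space Us) : nat :=
  ex_minn (tensor_rank_ex t).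

Lemma tensor_rankP Us (t : tensor_space Us) :
  rank_le t (tensor_rank t) /\ (forall r, rank_le t r -> (tensor_rank t <= r)%N).
Proof.
rewrite /tensor_rank; case: ex_minnP => r /asboolP tr rmin; split=> // q tq.
exact/rmin/asboolP.
Qed.

Fixpoint tensor_prod (Us Vs : seq (vectType K)) :
    tensor_space Us -> tensor_space Vs -> tensor_space (Us ++ Vs) :=
  if Us is U :: Us' then
    fun (s : tensor_space (U :: Us')) t => linfun (fun f => tensor_prod (s f) t)
  else fun (a : K^o) t => (a : K) *: t.

Lemma tensor_prod_linear Us Vs (t : tensor_space Vs) :
  linear ((@tensor_prod Us Vs)^~ t).
Proof.
elim: Us => [|U Us IH] a s1 s2 /=; first by rewrite scalerDl scalerA.
have lin (s : tensor_space (U :: Us)) : linear (fun f => tensor_prod (s f) t).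
  by move=> b f g; rewrite linearP IH.
pose L s : {linear 'Hom(U, K^o) -> tensor_space (Us ++ Vs)} :=
  HB.pack (fun f => tensor_prod ((s : tensor_space (U :: Us)) f) t)
    (GRing.isLinear.Build _ _ _ _ _ (lin s)).
apply/lfunP => f; rewrite add_lfunE scale_lfunE.
by rewrite (lfunE (L _)) (lfunE (L s1)) (lfunE (L s2)) /= add_lfunE scale_lfunE IH.
Qed.

(* The function passed to linfun in tensor_prod is linear, so linfun does not
   change it. *)
Lemma tensor_prodE (U : vectType K) Us Vs (s : tensor_space (U :: Us)) (t : tensor_space Vs) f :
  (tensor_prod s t : tensor_space (U :: Us ++ Vs)) f = tensor_prod (s f) t.
Proof.
have lin : linear (fun f => tensor_prod (s f) t).
  by move=> b g h; rewrite linearP tensor_prod_linear.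
pose L : {linear 'Hom(U, K^o) -> tensor_space (Us ++ Vs)} :=
  HB.pack (fun f => tensor_prod (s f) t) (GRing.isLinear.Build _ _ _ _ _ lin).
exact: (lfunE L).
Qed.

Lemma tensor_prod_pure (U : vectType K) Us Vs (u : U) (s : tensor_space Us)
    (t : tensor_space Vs) :
  tensor_prod (pure u s : tensor_space (U :: Us)) t = pure u (tensor_prod s t).
Proof.
apply/lfunP => f; rewrite tensor_prodE !pureE.
have := tensor_prod_linear t (f u : K) s 0.
have := tensor_prod_linear t (-1) (0 : tensor_space Us) 0.
by rewrite scaler0 addr0 scaleN1r addNr => -> /=; rewrite !addr0.
Qed.

Fixpoint tensor_pow Us (t : tensor_space Us) (n : nat) :
    tensor_space (flatten (nseq n Us)) :=
  if n is m.+1 then tensor_prod t (tensor_pow t m) else (1 : K).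

End TensorProduct.

Section BorderRank.
Variable K : numFieldType.

(* Convergence for the Euclidean topology of V: convergence in K of each
   coordinate in a fixed basis of V. *)
Definition vect_cvg (V : vectType K) (x : nat -> V) (l : V) : Prop :=
  forall i, coord (vbasis {:V}) i (x n) @[n --> \oo] --> coord (vbasis {:V}) i l.

Definition border_rank_le Us (t : tensor_space Us) (r : nat) : Prop :=
  exists x : nat -> tensor_space Us,
    (forall n, (tensor_rank (x n) <= r)%N) /\ vect_cvg x t.

Lemma border_rank_ex Us (t : tensor_space Us) :
  exists r, `[< border_rank_le t r >].
Proof.
exists (tensor_rank t); apply/asboolP; exists (fun=> t); split=> // i.
exact: cvg_cst.
Qed.

Definition border_rank Us (t : tensor_space Us) : nat :=
  ex_minn (border_rank_ex t).

End BorderRank.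

(* Main.v *)
Require Import Defs.
From HB Require Import structures.
From mathcomp Require Import all_boot all_order all_algebra.
From mathcomp Require Import complex.
From mathcomp Require Import ring.
From mathcomp Require Import all_classical all_reals all_analysis.

Set Implicit Arguments.
Unset Strict Implicit.
Unset Printing Implicit Defensive.

Import Order.TTheory GRing.Theory Num.Theory.
Import numFieldNormedType.Exports.

Local Open Scope classical_set_scope.
Local Open Scope ring_scope.
Local Open Scope complex_scope.

(** The inequality for powers is a dimension count combined with the closedness
    of finite-dimensional subspaces.  Let [t] be a limit of tensors [x_k] of
    rank at most [r], in a space of dimension [N].  The linear span of the
    powers [x_k^n] is closed, so it contains the limit [t^n] of these powers.
    The coordinates of a power [x^n] are homogeneous forms of degree [n] in the
    [N] coordinates of [x] ([tensor_pow_expand]), so all the powers lie in a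
    space of dimension at most [(n+1)^N], and [t^n] is a combination of that
    many [x_k^n], each of rank at most [r^n].  Thus
    [R(t^n) <= (n+1)^N r^n] ([border_rank_pow]), which for large [n] is smaller
    than [(r+1)^n <= R(t)^n] ([poly_lt_exp]). 

    For a pair of tensors with a strict inequality, take the three-tensor
    [W = e0 e0 e1 + e0 e1 e0 + e1 e0 e0].  It is tangent to the variety of
    simple tensors, hence of border rank at most 2 ([border_rank_Wstate]), but
    has rank at least 3 ([rank_Wstate]).  At the least exponent at which
    [R(W^n)] is smaller than [R(W)^n], multiplicativity fails for [W] and
    [W^(n-1)] ([tensor_rank_not_multiplicative]). *)

(** * Operations on tensors of bounded rank *)

Section Rank.
Variable K : fieldType.
Implicit Types Us Vs : seq (vectType K).

Lemma pureZl (U T : vectType K) (a : K) (u : U) (v : T) :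
  pure (a *: u) v = a *: pure u v.
Proof.
by apply/lfunP => f; rewrite scale_lfunE !pureE linearZ scalerA.
Qed.

Lemma simpleZ Us a (t : tensor_space Us) : simple t -> simple (a *: t).
Proof.
case: Us t => [//|U Us] t [u [v [sv ->]]].
by exists (a *: u), v; split; rewrite ?pureZl.
Qed.

Lemma simple0 Us : simple (0 : tensor_space Us).
Proof.
elim: Us => [//|U Us IH]; exists 0, 0; split=> //.
by apply/lfunP => f; rewrite pureE scaler0 zero_lfunE.
Qed.

Lemma rank_le0 Us m : rank_le (0 : tensor_space Us) m.
Proof.
by exists (fun=> 0); split=> [_|]; [exact: simple0|rewrite big1].
Qed.

Lemma rank_leW Us (t : tensor_space Us) p q :
  (p <= q)%N -> rank_le t p -> rank_le t q.
Proof.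
by move=> /subnKC <- tp; rewrite -(addr0 t); apply/rank_leD/rank_le0.
Qed.

Lemma rank_leZ Us a (t : tensor_space Us) r : rank_le t r -> rank_le (a *: t) r.
Proof.
move=> [x [sx ->]]; exists (fun i => a *: x i); split; last exact: scaler_sumr.
by move=> i; apply: simpleZ.
Qed.

Lemma rank_le_sum Us m r (t : 'I_m -> tensor_space Us) :
  (forall i, rank_le (t i) r) -> rank_le (\sum_i t i) (m * r).
Proof.
elim: m t => [|m IH] t tr; first by rewrite big_ord0; exact: rank_le0.
by rewrite big_ord_recl mulSn; apply: rank_leD => //; apply: IH.
Qed.

Lemma rank_le_simple Us (t : tensor_space Us) : simple t -> rank_le t 1.
Proof. by move=> st; exists (fun=> t); rewrite big_ord1. Qed.

Lemma tensor_rank_le Us (t : tensor_space Us) r :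
  (tensor_rank t <= r)%N <-> rank_le t r.
Proof.
have [tr rmin] := tensor_rankP t; split; last exact: rmin.
by move=> /rank_leW; apply.
Qed.

Lemma tensor_prod_linearr Us Vs (s : tensor_space Us) :
  linear (@tensor_prod K Us Vs s).
Proof.
elim: Us s => [|U Us IH] s a t1 t2 /=.
  by rewrite scalerDr !scalerA mulrC.
by apply/lfunP => f; rewrite add_lfunE scale_lfunE !tensor_prodE IH.
Qed.

Lemma tensor_prod_suml Us Vs I r (x : I -> tensor_space Us) (t : tensor_space Vs) :
  tensor_prod (\sum_(i <- r) x i) t = \sum_(i <- r) tensor_prod (x i) t.
Proof.
pose L : {linear tensor_space Us -> tensor_space (Us ++ Vs)} :=
  HB.pack (fun s => tensor_prod s t)
    (GRing.isLinear.Build _ _ _ _ _ (tensor_prod_linear t)).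
exact: (linear_sum L).
Qed.

Lemma tensor_prod_sumr Us Vs I r (s : tensor_space Us) (x : I -> tensor_space Vs) :
  tensor_prod s (\sum_(i <- r) x i) = \sum_(i <- r) tensor_prod s (x i).
Proof.
pose L : {linear tensor_space Vs -> tensor_space (Us ++ Vs)} :=
  HB.pack (tensor_prod s)
    (GRing.isLinear.Build _ _ _ _ _ (tensor_prod_linearr s)).
exact: (linear_sum L).
Qed.

Lemma tensor_prodZl Us Vs a (s : tensor_space Us) (t : tensor_space Vs) :
  tensor_prod (a *: s) t = a *: tensor_prod s t.
Proof.
pose L : {linear tensor_space Us -> tensor_space (Us ++ Vs)} :=
  HB.pack (fun s => tensor_prod s t)
    (GRing.isLinear.Build _ _ _ _ _ (tensor_prod_linear t)).
exact: (linearZ_LR L).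
Qed.

Lemma tensor_prodZr Us Vs a (s : tensor_space Us) (t : tensor_space Vs) :
  tensor_prod s (a *: t) = a *: tensor_prod s t.
Proof.
pose L : {linear tensor_space Vs -> tensor_space (Us ++ Vs)} :=
  HB.pack (tensor_prod s)
    (GRing.isLinear.Build _ _ _ _ _ (tensor_prod_linearr s)).
exact: (linearZ_LR L).
Qed.

Lemma simple_prod Us Vs (s : tensor_space Us) (t : tensor_space Vs) :
  simple s -> simple t -> simple (tensor_prod s t).
Proof.
elim: Us s => [|U Us IH] s; first by move=> _; apply: simpleZ.
move=> [u [v [sv ->]]] st; exists u, (tensor_prod v t); split; first exact: IH.
exact: tensor_prod_pure.
Qed.

Lemma rank_le_prod Us Vs (s : tensor_space Us) (t : tensor_space Vs) p q :
  rank_le s p -> rank_le t q -> rank_le (tensor_prod s t) (p * q).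
Proof.
move=> [x [sx ->]] [y [sy ->]]; rewrite tensor_prod_suml.
apply: rank_le_sum => i; rewrite tensor_prod_sumr.
exists (fun j => tensor_prod (x i) (y j)); split=> // j.
exact: simple_prod.
Qed.

Lemma rank_le_pow Us (t : tensor_space Us) r n :
  rank_le t r -> rank_le (tensor_pow t n) (r ^ n).
Proof.
move=> tr; elim: n => [|n IH]; first exact: rank_le_simple.
by rewrite expnS; apply: rank_le_prod.
Qed.

(** The n-th power of [x] is a polynomial in the coordinates of [x], in which
    each coordinate has degree at most n.  Only the number of these monomials
    matters afterwards: it is polynomial in n. *)
Lemma tensor_pow_expand Us n :
  exists B : {ffun 'I_(\dim {:tensor_space Us}) -> 'I_n.+1} ->
             tensor_space (flatten (nseq n Us)),
  forall x : tensor_space Us,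
    tensor_pow x n =
    \sum_(m : {ffun 'I_(\dim {:tensor_space Us}) -> 'I_n.+1})
      (\prod_i coord (vbasis {:tensor_space Us}) i x ^+ m i) *: B m.
Proof.
set N := \dim _; set b := vbasis _.
elim: n => [|n [B BE]].
  exists (fun=> 1 : K^o) => x /=.
  rewrite (bigD1 [ffun=> ord0]) //= [X in _ + X]big1 => [|m]; last first.
    by move=> /negP[]; apply/eqP/ffunP => i; rewrite ffunE [m i]ord1.
  by rewrite addr0 big1 ?scale1r // => i _; rewrite ffunE expr0.
pose shift (p : 'I_N * {ffun 'I_N -> 'I_n.+1}) : {ffun 'I_N -> 'I_n.+2} :=
  [ffun j => inord (p.2 j + (p.1 == j))].
(* The coefficient of a monomial collects the ways of writing it as a coordinate
   of the first factor times a monomial of the remaining power. *)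
exists (fun m => \sum_(p | shift p == m) tensor_prod b`_p.1 (B p.2)) => x.
rewrite /= {1}(coord_vbasis (memvf x)) BE -/b tensor_prod_suml.
under [LHS]eq_bigr => i _ do rewrite tensor_prodZl tensor_prod_sumr scaler_sumr.
rewrite pair_big (partition_big shift predT) //=; apply: eq_bigr => m _.
rewrite scaler_sumr; apply: eq_bigr => -[i k] /eqP <- /=.
rewrite tensor_prodZr scalerA; congr (_ *: _).
rewrite (bigD1 i) //= [RHS](bigD1 i) //= mulrA; congr (_ * _).
  by rewrite ffunE /= inordK eqxx addn1 ?exprS // ltnS.
apply: eq_bigr => j jni; rewrite ffunE /= eq_sym (negPf jni) addn0 inordK //.
by rewrite ltnW // ltnS.
Qed.

(** A free family of largest size among the vectors satisfying [P] spans them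
    all; it exists because the sizes are bounded by the dimension of [S]. *)
Lemma span_sub_finite (V : vectType K) (S : {vspace V}) (P : V -> Prop) :
  (forall v, P v -> v \in S) ->
  exists s : seq V, [/\ (size s <= \dim S)%N, forall v, v \in s -> P v
                     & forall v, P v -> v \in << s >>%VS].
Proof.
move=> PS.
pose Q k := `[< exists s : seq V, [/\ size s = k, free s & forall v, v \in s -> P v] >].
have Q0 : exists k, Q k.
  by exists 0%N; apply/asboolP; exists [::]; rewrite nil_free.
have Qb k : Q k -> (k <= \dim S)%N.
  move=> /asboolP[s [<- fs sP]]; rewrite -(eqP fs); apply: dimvS.
  by apply/span_subvP => v /sP /PS.
case: (ex_maxnP Q0 Qb) => k Qk kmax; have := Qb k Qk.
move/asboolP: Qk => [s [sk fs sP]] kS; exists s; rewrite sk; split=> // v Pv.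
apply: contraT => vs.
have : Q k.+1.
  apply/asboolP; exists (v :: s); split; first by rewrite /= sk.
    by rewrite free_cons vs.
  by move=> w; rewrite inE => /predU1P[->|/sP].
by move/kmax; rewrite ltnn.
Qed.
End Rank.

(** * Powers of a limit of tensors of bounded rank *)

Section Border.
Variable K : numFieldType.
Implicit Types Us : seq (vectType K).

Lemma vect_cvg_polynomial (V : vectType K) (x : nat -> V) (l : V) (I : finType)
    (e : I -> 'I_(\dim {:V}) -> nat) (a : I -> K) :
  vect_cvg x l ->
  (\sum_m (\prod_i coord (vbasis {:V}) i (x k) ^+ e m i) * a m) @[k --> \oo]
    --> \sum_m (\prod_i coord (vbasis {:V}) i l ^+ e m i) * a m.
Proof.
move=> xl; apply: cvg_big => [|m _]; first exact: add_continuous.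
apply: cvgM; last exact: cvg_cst.
apply: cvg_big => [|i _]; first exact: mul_continuous.
elim: (e m i) => [|d IH].
  by rewrite expr0; under eq_fun do rewrite expr0; exact: cvg_cst.
rewrite exprS; under eq_fun do rewrite exprS; apply: cvgM => //; exact: xl.
Qed.

(** The powers of the approximating tensors span a subspace of dimension at most
    the number of monomials, and the power of the limit lies in it. *)
Lemma border_rank_pow Us (t : tensor_space Us) r n : border_rank_le t r ->
  (tensor_rank (tensor_pow t n) <= n.+1 ^ \dim {:tensor_space Us} * r ^ n)%N.
Proof.
move=> [x [xr xt]]; apply/tensor_rank_le.
have [B BE] := tensor_pow_expand Us n.
pose P v := exists k, v = tensor_pow (x k) n.
have PS v : P v -> v \in <<codom B>>%VS.
  move=> [k ->]; rewrite BE; apply: memv_suml => m _.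
  by apply/memvZ/memv_span/codom_f.
have [s [sS sP Ps]] := span_sub_finite PS.
have ts : tensor_pow t n \in << s >>%VS.
  (* Each coordinate of [phi (y ^ n)] is a polynomial in the coordinates of [y],
     hence continuous, and it vanishes at all the [x k]. *)
  pose phi := (\1 - projv << s >>%VS)%VF.
  have phiE v : phi v = v - projv << s >>%VS v.
    by rewrite add_lfunE opp_lfunE id_lfunE.
  suff : phi (tensor_pow t n) = 0.
    by rewrite phiE => /eqP; rewrite subr_eq0 => /eqP ->; exact: memv_proj.
  rewrite [LHS](coord_vbasis (memvf _)); apply: big1 => j _.
  rewrite [coord _ _ _](_ : _ = 0) ?scale0r //.
  pose c := coord (vbasis {:tensor_space (flatten (nseq n Us))}) j.
  have cE y : c (phi (tensor_pow y n)) =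
      \sum_(m : {ffun 'I_(\dim {:tensor_space Us}) -> 'I_n.+1})
      (\prod_i coord (vbasis {:tensor_space Us}) i y ^+ m i) * c (phi (B m)).
    rewrite /c BE !linear_sum; apply: eq_bigr => m _.
    by rewrite !linearZ.
  have := vect_cvg_polynomial
    (e := fun (m : {ffun 'I_(\dim {:tensor_space Us}) -> 'I_n.+1}) i => m i)
    (a := fun m => c (phi (B m))) xt.
  rewrite -cE; under eq_fun => k.
    rewrite -cE phiE projv_id ?subrr ?[c 0]linear0; last by apply: Ps; exists k.
    over.
  by move=> /(cvg_unique (@norm_hausdorff _ _)) /(_ (cvg_cst 0)).
have {}sS : (size s <= n.+1 ^ \dim {:tensor_space Us})%N.
  apply: (leq_trans sS); apply: (leq_trans (dim_span _)).
  by rewrite size_codom card_ffun !card_ord.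
apply: (@rank_leW _ _ _ (size s * r ^ n)); first by rewrite leq_mul2r sS orbT.
rewrite (coord_span (X := in_tuple s) ts); apply: rank_le_sum => i; apply: rank_leZ.
have [k ->] := sP _ (mem_nth 0 (ltn_ord i)).
exact/rank_le_pow/tensor_rank_le.
Qed.
End Border.

(** With m the quotient of n by N+1, the product of N+1 copies of the Bernoulli
    inequality for the exponent m gives a polynomial gain of degree N+1 in n of
    [(r+1)^n] over [r^n], against the degree N of [(n+1)^N]. *)
Lemma poly_lt_exp N r : exists n0, forall n, (n0 <= n)%N ->
  (n.+1 ^ N * r ^ n < r.+1 ^ n)%N.
Proof.
case: r => [|r].
  by exists 1%N => -[//|n _]; rewrite exp0n ?muln0 ?expn_gt0.
move: r.+1 (ltn0Sn r) => {r} p p_gt0; exists (N.+1 * (N.+1 ^ N * p ^ N.+1))%N => n n0n.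
pose m := (n %/ N.+1)%N.
have mlarge : (N.+1 ^ N * p ^ N.+1 < m + p)%N.
  by rewrite -[ltnLHS]addn0 -addnS leq_add // leq_divRL // mulnC.
have bern k : ((k + p) * p ^ k <= p * p.+1 ^ k)%N.
  elim: k => [|k IH]; first by rewrite !expn0.
  have -> : ((k.+1 + p) * p ^ k.+1 = p * ((k + p) * p ^ k) + p * p ^ k)%N.
    by rewrite expnS addSn; ring.
  have -> : (p * p.+1 ^ k.+1 = p * (p * p.+1 ^ k) + p * p.+1 ^ k)%N.
    by rewrite expnS; ring.
  have pk : (p ^ k <= p.+1 ^ k)%N by case: (k) => // j; rewrite leq_exp2r.
  by rewrite leq_add // leq_mul2l ?IH ?pk orbT.
have nE := divn_eq n N.+1.
have npow : ((m + p) ^ N.+1 * p ^ n <= p ^ N.+1 * p.+1 ^ n)%N.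
  rewrite nE -/m !expnD !expnM !mulnA -!expnMn leq_mul //.
    by rewrite leq_exp2r // bern.
  by case: (n %% N.+1)%N => // s; rewrite leq_exp2r.
have n1 : (n.+1 <= N.+1 * (m + p))%N.
  rewrite (leq_trans (ltn_ceil n (ltn0Sn N))) // mulnC leq_mul2l -/m -[m.+1]addn1.
  by rewrite leq_add2l p_gt0 orbT.
suff : (p ^ N.+1 * (n.+1 ^ N * p ^ n) < p ^ N.+1 * p.+1 ^ n)%N.
  by rewrite ltn_pmul2l // expn_gt0 p_gt0.
apply: leq_trans npow; rewrite mulnA ltn_pmul2r ?expn_gt0 ?p_gt0 //.
apply: (@leq_ltn_trans (p ^ N.+1 * (N.+1 * (m + p)) ^ N)%N).
  by rewrite leq_mul2l; case: (N) n1 => [|N'] n1; rewrite ?expn0 ?leqnn ?leq_exp2r ?n1 ?orbT.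
rewrite expnMn mulnA [(p ^ _ * _)%N]mulnC (expnS (m + p)).
by rewrite ltn_pmul2r // expn_gt0 addn_gt0 p_gt0 orbT.
Qed.

Lemma tensor_rank_pow_lt (K : numFieldType) (Us : seq (vectType K)) (t : tensor_space Us) :
  (border_rank t < tensor_rank t)%N ->
  exists n0 : nat, forall n : nat, (n0 <= n)%N ->
    (tensor_rank (tensor_pow t n) < tensor_rank t ^ n)%N.
Proof.
rewrite /border_rank; case: ex_minnP => r /asboolP tr _ rt.
have [n0 n0P] := poly_lt_exp (\dim {:tensor_space Us}) r.
exists n0 => n /n0P; move/(leq_ltn_trans (border_rank_pow n tr)) => /leq_trans; apply.
by case: n => // n; rewrite leq_exp2r.
Qed.

(** * The tensor W: rank three *)

Section W.
Variables (K : fieldType) (U : vectType K) (e0 e1 : U).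

Let V3 := [:: U; U; U].

Definition pure3 (a b c : U) : tensor_space V3 :=
  pure a (pure b (pure c (1 : K^o))).

Definition Wstate : tensor_space V3 :=
  pure3 e0 e0 e1 + pure3 e0 e1 e0 + pure3 e1 e0 e0.

Definition val3 (t : tensor_space V3) (f g h : 'Hom(U, K^o)) : K :=
  ((t f : tensor_space [:: U; U]) g : tensor_space [:: U]) h.

Lemma val3_pure a b c s f g h :
  val3 (pure a (pure b (pure c (s : K^o)))) f g h = f a * g b * h c * s.
Proof.
rewrite /val3 !pureE !scale_lfunE !pureE !scale_lfunE !pureE.
by rewrite /GRing.scale /= !mulrA.
Qed.

Lemma val3D s t f g h : val3 (s + t) f g h = val3 s f g h + val3 t f g h.
Proof. by rewrite /val3 !add_lfunE. Qed.

Lemma val3Z a t f g h : val3 (a *: t) f g h = a * val3 t f g h.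
Proof. by rewrite /val3 !scale_lfunE. Qed.

Lemma val3P s t : (forall f g h, val3 s f g h = val3 t f g h) -> s = t.
Proof. by move=> st; do 3 (apply/lfunP => ?); apply: st. Qed.

(** The equation typechecks because appending the empty list to a closed list of
    spaces computes. *)
Lemma Wstate_prod1 : tensor_prod Wstate (1 : tensor_space [::]) = Wstate.
Proof.
apply/lfunP => f; refine (etrans (@tensor_prodE K U [:: U; U] [::] _ _ f) _).
apply/lfunP => g; refine (etrans (@tensor_prodE K U [:: U] [::] _ _ g) _).
apply/lfunP => h; refine (etrans (@tensor_prodE K U [::] [::] _ _ h) _).
exact: mulr1.
Qed.

(** The difference quotient of the curve of cubes of [e0 + eps *: e1], whose
    derivative at 0 is W. *)
Lemma Wstate_secant (eps : K) : eps != 0 ->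
  let y := e0 + eps *: e1 in
  eps^-1 *: pure3 y y y + (- eps^-1) *: pure3 e0 e0 e0 =
  Wstate + (eps *: (pure3 e0 e1 e1 + pure3 e1 e0 e1 + pure3 e1 e1 e0)
            + (eps * eps) *: pure3 e1 e1 e1).
Proof.
move=> eps0 y; apply: val3P => f g h; rewrite !(val3D, val3Z) !val3_pure.
have yE (k : 'Hom(U, K^o)) : k y = (k e0 : K) + eps * k e1 :> K.
  by rewrite linearD linearZ.
by rewrite !yE; field.
Qed.

Lemma simple_pure3 a b c : simple (pure3 a b c).
Proof.
exists a, (pure b (pure c (1 : K^o))); split=> //.
by exists b, (pure c (1 : K^o)); split=> //; exists c, (1 : K^o).
Qed.

Variables f0 f1 : 'Hom(U, K^o).
Hypotheses (f00 : f0 e0 = 1) (f01 : f0 e1 = 0) (f10 : f1 e0 = 0) (f11 : f1 e1 = 1).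

(** Contracting the first factor of W with a form [f] gives a 2 by 2 matrix of
    determinant [- (f e0) ^ 2].  If W is a sum of two simple tensors with first
    factors [a1] and [a2], this determinant is a multiple of [f a1 * f a2], so
    [f e0 = 0] as soon as [f] vanishes at [a1] or at [a2].  Hence both are
    proportional to [e0], and the contraction of W with [f1] would vanish. *)
Lemma rank_Wstate : (2 < tensor_rank Wstate)%N.
Proof.
rewrite ltnNge; apply/negP => /tensor_rank_le[x [sx Wx]].
have [a1 [_ [[b1 [_ [[c1 [s1 [_ ->]]] ->]]] x1]]] := sx ord0.
have [a2 [_ [[b2 [_ [[c2 [s2 [_ ->]]] ->]]] x2]]] := sx (lift ord0 ord0).
rewrite big_ord_recl big_ord1 x1 x2 in Wx.
have E (f g h : 'Hom(U, K^o)) :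
    f e0 * (g e0 * h e1 + g e1 * h e0) + f e1 * (g e0 * h e0) =
    f a1 * (g b1 * h c1 * (s1 : K)) + f a2 * (g b2 * h c2 * (s2 : K)) :> K.
  have := congr1 (fun w => val3 w f g h) Wx.
  by rewrite !val3D !val3_pure !mulr1 !mulrA => <-; ring.
(* The determinant of a sum of two matrices of rank one is the product of the
   2 by 2 determinants of their left and right factors. *)
have fa (f : 'Hom(U, K^o)) : (f a1 : K) * f a2 = 0 -> f e0 = 0.
  move=> fa0; apply/eqP; rewrite -[_ == _]sqrf_eq0; apply/eqP.
  have := E f f0 f0; have := E f f0 f1; have := E f f1 f0; have := E f f1 f1.
  rewrite f00 f01 f10 f11 !(mul0r, mulr0, mul1r, mulr1, add0r, addr0).
  move=> E11 E10 E01 E00; rewrite expr2 {1}E01 E10.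
  transitivity (- (f a1 * f a2) * ((f0 b1 * f1 b2 - f1 b1 * f0 b2) *
    (f0 c1 * f1 c2 - f1 c1 * f0 c2) * s1 * s2)
    + (f a1 * (f0 b1 * f0 c1 * s1) + f a2 * (f0 b2 * f0 c2 * s2)) *
      (f a1 * (f1 b1 * f1 c1 * s1) + f a2 * (f1 b2 * f1 c2 * s2)) : K).
    by ring.
  by rewrite fa0 -E11 oppr0 mul0r mulr0 addr0.
(* The form below vanishes at [a], and its value at [e0] is [- f1 a]. *)
have f1a a : (forall f : 'Hom(U, K^o), f a = 0 -> f e0 = 0) -> f1 a = 0.
  move=> /(_ ((f0 a : K) *: f1 - (f1 a : K) *: f0)).
  rewrite !add_lfunE !opp_lfunE !scale_lfunE f00 f10 scaler0 add0r.
  rewrite /GRing.scale /= mulr1 mulrC subrr => /(_ erefl)/eqP.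
  by rewrite oppr_eq0 => /eqP.
have := E f1 f0 f0; rewrite (f1a a1) => [|f fa1]; last by apply: fa; rewrite fa1 mul0r.
rewrite (f1a a2) => [|f fa2]; last by apply: fa; rewrite fa2 mulr0.
rewrite f00 f01 f10 f11 !(mul0r, mulr0, mul1r, mulr1, add0r, addr0).
by move/eqP; rewrite oner_eq0.
Qed.

End W.

(** * The tensor W: border rank two *)

Lemma vect_cvgD (K : numFieldType) (V : vectType K) (x y : nat -> V) (l m : V) :
  vect_cvg x l -> vect_cvg y m -> vect_cvg (fun n => x n + y n) (l + m).
Proof.
move=> xl ym i; rewrite linearD; under eq_fun do rewrite linearD.
exact: (cvgD (xl i) (ym i)).
Qed.

Lemma vect_cvgZ0 (K : numFieldType) (V : vectType K) (a : nat -> K) (v : V) :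
  a n @[n --> \oo] --> 0 -> vect_cvg (fun n => a n *: v) 0.
Proof.
move=> a0 i; rewrite linear0 -(mul0r (coord (vbasis {:V}) i v)).
under eq_fun do rewrite linearZ.
exact: (cvgM a0 (cvg_cst _)).
Qed.

(** W is a limit of points on secant lines of the cone of simple tensors. *)
Lemma border_rank_Wstate (K : numFieldType) (U : vectType K) (e0 e1 : U)
    (eps : nat -> K) :
  (forall n, eps n != 0) -> eps n @[n --> \oo] --> 0 ->
  (border_rank (Wstate e0 e1) <= 2)%N.
Proof.
move=> eps0 epscvg; rewrite /border_rank.
case: ex_minnP => r _; apply; apply/asboolP.
exists (fun n => let y := e0 + eps n *: e1 in
  (eps n)^-1 *: pure3 y y y + (- (eps n)^-1) *: pure3 e0 e0 e0); split=> [n|i].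
  apply/tensor_rank_le/(@rank_leD _ _ _ _ 1 1);
    by apply/rank_leZ/rank_le_simple/simple_pure3.
under eq_fun => n do rewrite /= (Wstate_secant _ _ (eps0 n)).
move: i; rewrite -/(vect_cvg _ _) -[X in vect_cvg _ X]addr0.
apply: vect_cvgD; first by move=> i; exact: cvg_cst.
rewrite -[X in vect_cvg _ X]addr0; apply: vect_cvgD; apply: vect_cvgZ0 => //.
by rewrite -(mul0r 0); exact: cvgM.
Qed.

Lemma cvg_harmonic_complex (R : realType) :
  (n.+1%:R^-1 : (R[i] : numFieldType)) @[n --> \oo]
    --> (0 : (R[i] : numFieldType)).
Proof.
apply/cvgrPdist_lt => -[e ie]; rewrite ltcE /= => /andP[/eqP -> e0].
have /cvgrPdist_lt/(_ e e0) := @cvg_harmonic R.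
apply: filterS => n; rewrite !sub0r !normrN.
have -> : (n.+1%:R^-1 : R[i]) = (n.+1%:R^-1 : R)%:C.
  by rewrite fmorphV rmorph_nat.
by rewrite !ger0_norm ?invr_ge0 ?ler0n ?ltcR // lecR invr_ge0.
Qed.

(** * Failure of multiplicativity *)

Lemma tensor_rank_not_multiplicative (K : numFieldType) (eps : nat -> K) :
  (forall n, eps n != 0) -> eps n @[n --> \oo] --> 0 ->
  exists (Us Vs : seq (vectType K)) (s : tensor_space Us) (t : tensor_space Vs),
    (0 < size Us)%N /\ (0 < size Vs)%N /\
    (tensor_rank (tensor_prod s t) < tensor_rank s * tensor_rank t)%N.
Proof.
move=> eps0 epscvg; pose U : vectType K := (K^o * K^o)%type.
pose e0 : U := (1, 0); pose e1 : U := (0, 1).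
pose f0 : 'Hom(U, K^o) := linfun fst; pose f1 : 'Hom(U, K^o) := linfun snd.
pose W := Wstate e0 e1.
have W3 : (2 < tensor_rank W)%N.
  by apply: (@rank_Wstate _ _ _ _ f0 f1); rewrite lfunE.
have [n0 n0P] : exists n0 : nat, forall n, (n0 <= n)%N ->
    (tensor_rank (tensor_pow W n) < tensor_rank W ^ n)%N.
  apply: tensor_rank_pow_lt; apply: leq_ltn_trans W3.
  exact: border_rank_Wstate eps0 epscvg.
pose Q n := (tensor_rank (tensor_pow W n.+1) < tensor_rank W ^ n.+1)%N.
have exQ : exists n, Q n by exists n0; apply: n0P.
case: (ex_minnP exQ) => -[|n] Qn nmin.
  have W1 : tensor_rank (tensor_pow W 1) = tensor_rank W.
    exact: (congr1 (@tensor_rank _ [:: U; U; U]) (Wstate_prod1 e0 e1)).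
  by move: Qn; rewrite /Q W1 expn1 ltnn.
have : ~~ Q n by apply/negP => /nmin; rewrite ltnn.
rewrite /Q -leqNgt => Wn.
exists [:: U; U; U], (flatten (nseq n.+1 [:: U; U; U])), W, (tensor_pow W n.+1).
do 2!split=> //; apply: (leq_trans Qn).
by rewrite expnS leq_mul2l Wn orbT.
Qed.

Theorem mainTheorem1 (R : realType) :
  (exists (Us Vs : seq (vectType R[i]))
          (s : tensor_space Us) (t : tensor_space Vs),
      (0 < size Us)%N /\ (0 < size Vs)%N /\
      (tensor_rank (tensor_prod s t) < tensor_rank s * tensor_rank t)%N) /\
  (forall Us : seq (vectType R[i]), (0 < size Us)%N ->
   forall t : tensor_space Us,
     (border_rank t < tensor_rank t)%N ->
     exists n0 : nat, forall n : nat, (n0 <= n)%N ->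
       (tensor_rank (tensor_pow t n) < tensor_rank t ^ n)%N).
Proof.
split; last by move=> Us _ t; exact: tensor_rank_pow_lt.
apply: (tensor_rank_not_multiplicative _ (@cvg_harmonic_complex R)) => n.
by rewrite invr_eq0 pnatr_eq0.
Qed.
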